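(* For every integer $d\geq 360756$ we have $C(d,2)>0.684\,d^2$.
   Context: $C(d,2)$ denotes the largest number of vertices of a Cayley graph of diameter two and degree $d$. Here, for a finite group $\Gamma$ and a generating set $X\subset\Gamma$ with $1_\Gamma\notin X$ and $X=X^{-1}$, the Cayley graph $\mathrm{Cay}(\Gamma,X)$ has vertex set $\Gamma$ and edges $\{g,h\}$ whenever $g^{-1}h\in X$; its degree is $|X|$. *)

(* Defs.v *)
From mathcomp Require Import all_boot all_fingroup.
Set Implicit Arguments. Unset Strict Implicit. Unset Printing Implicit Defensive.
Local Open Scope group_scope.

Definition cay_adj (gT : finGroupType) (X : {set gT}) (g h : gT) : bool :=
  g^-1 * h \in X.

Definition cay_diam_le2 (gT : finGroupType) (X : {set gT}) : Prop :=
  forall g h : gT, g = h \/ cay_adj X g h \/ exists k, cay_adj X g k /\ cay_adj X k h.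

Definition cay_diam2 (gT : finGroupType) (X : {set gT}) : Prop :=
  cay_diam_le2 X /\ exists g h : gT, g <> h /\ ~~ cay_adj X g h.

Definition cayley_set (gT : finGroupType) (X : {set gT}) (d : nat) : Prop :=
  [/\ (1 : gT) \notin X, X^-1 = X, <<X>> = [set: gT] & #|X| = d].

(* "n <= C(d,2)" : some Cayley graph of degree d and diameter two has n vertices
   or more. Since C(d,2) is a maximum, C(d,2) > b iff such a graph with > b
   vertices exists. *)
Definition cayley_d2_exists_gt (d : nat) (P : nat -> Prop) : Prop :=
  exists (gT : finGroupType) (X : {set gT}), cayley_set X d /\ cay_diam2 X /\ P #|gT|.

(* Main.v *)
Require Import Defs.
From Stdlib Require DecimalNat.
From HB Require Import structures.
From mathcomp Require Import all_boot all_fingroup all_algebra all_field.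
From mathcomp Require Import zify ring.
Set Implicit Arguments. Unset Strict Implicit. Unset Printing Implicit Defensive.
Import GRing.Theory.

(** Let [F1] be the field of order [9^r], [F2] the field of prime order [p] and
    [q = 9^r * p]. The group is the extension of the additive group
    [F1^2 * F2^2] by an involution acting as [-psi], where [psi] is the
    Frobenius power [x |-> x^(3^r)] (of order two) on [F1] and the identity on
    [F2]. The parabola [E = {(s, s^2)}], placed in the nontrivial coset, is
    stable under [psi], and [E E = E - E] contains every vector whose two
    [s]-coordinates are nonzero. A vector of the coset is [v + e] with [e] in
    [E] and [v] vertical; it is a product of generators when [v] or [psi v] is
    one, and since [psi] is not [+1] or [-1] on the vertical vectors, a
    symmetric set of about half of them is enough. The vectors with a zero
    [s]-coordinate need only [O(9^r + p)] further generators. This gives order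
    [2 q^2] for degree about [3 q / 2], a ratio near 8/9. The slack between 8/9
    and 0.684 absorbs gaps of 10% between consecutive values of [q], so finitely
    many primes, multiplied by the powers of 9, reach all degrees. *)

(** * Extension of a finite abelian group by an involution *)

Section InvolutionExtension.
Variables (A : finZmodType) (f : A -> A).
Local Open Scope ring_scope.
Hypotheses (fD : {morph f : x y / x + y}) (fK : involutive f).

(** The hypotheses on [f] are parameters of the type so that the group structure declared on it can
    recover them. *)
Definition invol_ext of {morph f : x y / x + y} & involutive f : Type :=
  (A * bool)%type.
Local Notation G := (invol_ext fD fK).
HB.instance Definition _ := Finite.on G.

Definition tw (s : bool) (a : A) := if s then f a else a.
Definition ext_mul (u v : G) : G := (u.1 + tw u.2 v.1, u.2 (+) v.2).
Definition ext_one : G := (0, false).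
Definition ext_inv (u : G) : G := (tw u.2 (- u.1), u.2).

Lemma tw_add s a b : tw s (a + b) = tw s a + tw s b.
Proof. by case: s => //=; exact: fD. Qed.

Lemma tw_tw s t a : tw s (tw t a) = tw (s (+) t) a.
Proof. by case: s; case: t => //=; exact: fK. Qed.

Lemma ext_mulA : associative ext_mul.
Proof.
by move=> [a s] [b t] [c w]; rewrite /ext_mul /= tw_add tw_tw addrA addbA.
Qed.

Lemma ext_mul1 : left_id ext_one ext_mul.
Proof. by move=> [a s]; rewrite /ext_mul /= add0r. Qed.

Lemma ext_mulV : left_inverse ext_one ext_inv ext_mul.
Proof.
move=> [a s]; rewrite /ext_mul /ext_inv /= -tw_add addNr addbb.
have f0 : f 0 = 0 by apply: (addrI (f 0)); rewrite -fD !addr0.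
by case: s => //=; rewrite f0.
Qed.

HB.instance Definition _ :=
  Finite_isGroup.Build G ext_mulA ext_mul1 ext_mulV.

Lemma card_invol_ext : #|{: G}| = (#|A| * 2)%N.
Proof. by rewrite -card_bool -card_prod. Qed.

End InvolutionExtension.

(** * Enlarging a covering set to a prescribed degree *)

Section Padding.
Variable gT : finGroupType.
Local Open Scope group_scope.

(* The involution [z] is kept in reserve to correct the parity of [d - #|X|]. *)
Lemma symmetric_superset (X : {set gT}) (z : gT) (d : nat) :
  X^-1 = X -> 1 \notin X -> z^-1 = z -> z != 1 -> z \notin X ->
  #|X| <= d -> d.+2 <= #|gT| ->
  exists Y : {set gT}, [/\ X \subset Y, Y^-1 = Y, 1 \notin Y & #|Y| = d].
Proof.
move=> Xi X1 zi z1 zX Xd dG.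
pose P (Y : {set gT}) :=
  [&& X \subset Y, Y^-1 == Y, 1 \notin Y, z \notin Y & #|Y| <= d].
(* A maximal [Y] has [d] or [d - 1] elements: with two free places, some [y] and its inverse could
   still be added. *)
have [|Y /maxsetP [/and5P [XY /eqP Yi Y1 zY Yd] Ymax] _] := @maxset_exists _ P X.
  by rewrite /P subxx Xi eqxx X1 zX.
have [Yed|Ynd] := eqVneq #|Y| d; first by exists Y.
have [Yd1|Ynd1] := eqVneq #|Y|.+1 d.
  exists (z |: Y); split.
  - by apply: subset_trans XY _; apply: subsetUr.
  - by rewrite invUg invg_set1 zi Yi.
  - by rewrite !inE negb_or Y1 eq_sym z1.
  - by rewrite cardsU1 zY.
have Y2 : #|Y| + 2 <= d by lia.
have [y yN] : exists y, y \notin 1 |: (z |: Y).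
  apply/existsP; rewrite -negb_forall; apply/negP => /forallP H.
  have : d.+2 <= #|1 |: (z |: Y)|.
    by apply: leq_trans dG _; apply/subset_leq_card/subsetP => x _.
  rewrite !cardsU1; move: Y2; set m := #|Y|.
  by case: (_ \notin _); case: (_ \notin _); lia.
move: yN; rewrite !inE !negb_or => /and3P [y1 yz yY].
suff : y |: (y^-1 |: Y) = Y by move=> E; move: yY; rewrite -E !inE eqxx.
apply: Ymax; last by rewrite setUA subsetUr.
apply/and5P; split.
- by apply: subset_trans XY _; rewrite setUA subsetUr.
- by rewrite !invUg !invg_set1 Yi invgK setUCA.
- by rewrite !inE !negb_or Y1 eq_sym y1 eq_sym invg_eq1 y1.
- by rewrite !inE !negb_or zY eq_sym yz eq_sym -(inj_eq invg_inj) invgK zi yz.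
- rewrite !cardsU1; move: Y2; set m := #|Y|.
  by case: (_ \notin _); case: (_ \notin _); lia.
Qed.

(** Adjacency is invariant under left translation, so distances need only be checked from the
    identity. *)
Definition covers (X : {set gT}) :=
  forall g : gT, [|| g == 1, g \in X | [exists a in X, a^-1 * g \in X]].

(** Covering passes to supersets, and gives both generation and diameter at most two. The bound
    [d.+2 <= #|gT|] leaves a vertex outside [1 |: Y], so the diameter is not smaller. *)
Lemma cayley_of_cover (X : {set gT}) (z : gT) (d : nat) (Q : nat -> Prop) :
  X^-1 = X -> 1 \notin X -> z^-1 = z -> z != 1 -> z \notin X ->
  #|X| <= d -> d.+2 <= #|gT| -> covers X -> Q #|gT| ->
  cayley_d2_exists_gt d Q.
Proof.
move=> Xi X1 zi z1 zX Xd dG cX QG.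
have [Y [XY Yi Y1 Yd]] := symmetric_superset Xi X1 zi z1 zX Xd dG.
have cY g : [\/ g = 1, g \in Y | exists2 a, a \in Y & a^-1 * g \in Y].
  case/or3P: (cX g) => [/eqP-> | gX | /exists_inP [a aX agX]].
  - by constructor 1.
  - by constructor 2; apply: (subsetP XY).
  - by constructor 3; exists a; apply: (subsetP XY).
exists gT, Y; split; last split=> //.
  split=> //; apply/setP => g; rewrite inE.
  case: (cY g) => [-> | gY | [a aY agY]]; first exact: group1.
    exact: mem_gen.
  by rewrite -(mulKVg a g) groupM // mem_gen.
split.
- move=> g h; case: (cY (g^-1 * h)) => [E | E | [a aY E]].
  + by left; apply/eqP; rewrite eq_mulVg1 E.
  + by right; left.
  + right; right; exists (g * a); split; first by rewrite /cay_adj mulKg.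
    by rewrite /cay_adj invMg -mulgA.
- have [y yN] : exists y, y \notin 1 |: Y.
    apply/existsP; rewrite -negb_forall; apply/negP => /forallP H.
    have : d.+2 <= #|1 |: Y|.
      by apply: leq_trans dG _; apply/subset_leq_card/subsetP => x _.
    by rewrite cardsU1 Y1 Yd; lia.
  move: yN; rewrite !inE negb_or => /andP [y1 yY].
  exists 1, y; split; first by move=> E; rewrite -E eqxx in y1.
  by rewrite /cay_adj invg1 mul1g.
Qed.

End Padding.

HB.saturate prod.

(** * The generating set built from the parabola, and its covering property *)

Section Construction.
Variables (F1 F2 : finFieldType) (sg : F1 -> F1).
Local Open Scope ring_scope.
Hypotheses (sgD : {morph sg : x y / x + y}) (sgM : {morph sg : x y / x * y}).
Hypotheses (sgK : involutive sg).
Hypotheses (F1_2 : (2 : F1) != 0) (F2_2 : (2 : F2) != 0).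
Variables (P1 : pred F1) (P2 : pred F2) (h : F2).
Hypothesis P1N : forall x, x != 0 -> P1 (- x) = ~~ P1 x.
Hypothesis P2N : forall x, x != 0 -> P2 (- x) = ~~ P2 x.
(* In [F_p], with [P2] the residues up to [(p-1)/2] and [h = (p-1)/2]. *)
Hypothesis P2_sub : forall x, x != 0 -> P2 x -> (x - h == 0) || ~~ P2 (x - h).
Hypothesis P2_add : forall x, x != 0 -> ~~ P2 x -> (x + h == 0) || P2 (x + h).

Local Notation A := ((F1 * F1) * (F2 * F2))%type.

Lemma sg0 : sg 0 = 0.
Proof. by apply: (addrI (sg 0)); rewrite -sgD !addr0. Qed.

Lemma sgN x : sg (- x) = - sg x.
Proof. by apply: (addrI (sg x)); rewrite -sgD !subrr sg0. Qed.

Lemma sg1 : sg 1 = 1.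
Proof.
have n0 : sg 1 != 0.
  by apply/eqP => E; have := sgK 1; rewrite E sg0 => /esym/eqP; rewrite oner_eq0.
by apply: (mulfI n0); rewrite -sgM !mulr1.
Qed.

(** This is [-psi]. In the nontrivial coset the sign makes products differences of parabola points,
    up to [psi], and makes inversion act as [psi]. *)
Definition twist (g : A) : A :=
  ((- sg g.1.1, - sg g.1.2), (- g.2.1, - g.2.2)).

Lemma twistD : {morph twist : x y / x + y}.
Proof.
by move=> [[a b] [c d]] [[a' b'] [c' d']]; rewrite /twist /= !sgD !opprD.
Qed.

Lemma twistK : involutive twist.
Proof.
by move=> [[a b] [c d]]; rewrite /twist /= !sgN !sgK !opprK.
Qed.

Local Notation G := (@invol_ext (A : finZmodType) twist twistD twistK).

(* The part of [b.1] on which Frobenius is [-1] is [b.1 - sg b.1]: negation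
   reverses the sign of both components, Frobenius that of the first only. *)
Definition half (b : F1 * F2) :=
  (b != 0) && [|| b.1 - sg b.1 == 0, b.2 == 0 | P1 (b.1 - sg b.1) == P2 b.2].

Lemma halfN b1 b2 : half (- b1, - b2) = half (b1, b2).
Proof.
rewrite /half !xpair_eqE !oppr_eq0 sgN -opprD !oppr_eq0 /=; congr andb.
have [//|y0] := eqVneq (b1 - sg b1) 0; have [//|b0] := eqVneq b2 0.
by rewrite P1N // P2N // !orFb; case: P1; case: P2.
Qed.

Lemma half_sg b1 b2 : [|| (b1, b2) == 0, half (b1, b2) | half (sg b1, b2)].
Proof.
have [//|b0] := eqVneq (b1, b2) 0; rewrite /half b0 /= sgK.
have sb0 : (sg b1, b2) != 0.
  apply: contra b0; rewrite !xpair_eqE /= => /andP [/eqP E ->].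
  by rewrite -(sgK b1) E sg0 eqxx.
rewrite sb0 /=; have [//|y0] := eqVneq (b1 - sg b1) 0.
have [//|b20] := eqVneq b2 0; rewrite -(opprB b1) P1N //.
by case: P1; case: P2; rewrite ?orbT.
Qed.

Definition shift (i : 'I_3) : F2 := nth 0 [:: 0; h; - h] i.

(** If [half] fails on a nonzero vector, [P1] and [P2] disagree there. Moving [b2] by [h] or [-h]
    puts it in the other class of [P2] or at 0, and [half] accepts both as long as the vector stays
    nonzero. *)
Lemma half_shift b1 b2 :
  exists i, ((b1, b2 - shift i) == 0) || half (b1, b2 - shift i).
Proof.
have [E|b0] := eqVneq (b1, b2) 0; first by exists ord0; rewrite subr0 E eqxx.
have [H|] := boolP (half (b1, b2)); first by exists ord0; rewrite subr0 H orbT.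
rewrite /half b0 !negb_or /= => /and3P [y0 b20 ne].
have {}ne : P1 (b1 - sg b1) = ~~ P2 b2 by move: ne; case: P1; case: P2.
have [p|p] := boolP (P2 b2).
- exists (inord 1); rewrite /shift inordK //= /half.
  case: eqP => //= _; rewrite ne p /=.
  by case/orP: (P2_sub b20 p) => [-> | /negbTE ->]; rewrite ?orbT.
- exists (inord 2); rewrite /shift inordK //= opprK /half.
  case: eqP => //= _; rewrite ne p /=.
  by case/orP: (P2_add b20 p) => ->; rewrite ?orbT.
Qed.

Definition parab (s : F1 * F2) : G :=
  (((s.1, s.1 ^+ 2), (s.2, s.2 ^+ 2)), true).
Definition vert (b : F1 * F2) : G := (((0, b.1), (0, b.2)), false).
(** These reach the vectors with exactly one nonzero [s]-coordinate [a.1]; the three shifts allow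
    the vertical remainder to be brought into [half] or to 0. *)
Definition fib1 (a : F1 * 'I_3) : G := (((a.1, 0), (0, shift a.2)), false).
Definition fib2 (a : F2 * 'I_3) : G := (((0, 0), (a.1, shift a.2)), false).

Definition gens : {set G} :=
  [set g | (g \in parab @: setT) || (g \in vert @: [set b | half b])
        || (g \in fib1 @: [set a | a.1 != 0]) || (g \in fib2 @: [set a | a.1 != 0])].


Variant gens_spec (g : G) : Prop :=
| GensParab s of g = parab s
| GensVert b of half b & g = vert b
| GensFib1 a of a.1 != 0 & g = fib1 a
| GensFib2 a of a.1 != 0 & g = fib2 a.

Lemma gensP (g : G) : g \in gens -> gens_spec g.
Proof.
rewrite inE -!orbA => /or4P [/imsetP[s _] | /imsetP[b] | /imsetP[a] | /imsetP[a]].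
- exact: GensParab.
- by rewrite inE; exact: GensVert.
- by rewrite inE; exact: GensFib1.
- by rewrite inE; exact: GensFib2.
Qed.

Lemma parab_gens s : parab s \in gens.
Proof. by rewrite inE imset_f ?inE. Qed.

Lemma vert_gens b : half b -> vert b \in gens.
Proof. by move=> hb; rewrite inE (imset_f vert) ?inE ?orbT. Qed.

Lemma fib1_gens a : a.1 != 0 -> fib1 a \in gens.
Proof. by move=> ha; rewrite inE (imset_f fib1) ?inE ?orbT. Qed.

Lemma fib2_gens a : a.1 != 0 -> fib2 a \in gens.
Proof. by move=> ha; rewrite inE (imset_f fib2) ?inE ?orbT. Qed.

Lemma shiftN i : exists j, shift j = - shift i.
Proof.
case: i => [[|[|[|//]]] hi]; rewrite /shift /=.
- by exists ord0; rewrite oppr0.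
- by exists (inord 2); rewrite inordK.
- by exists (inord 1); rewrite inordK //= opprK.
Qed.

Lemma gens_inv_sub g : g \in gens -> (g^-1)%g \in gens.
Proof.
case/gensP => [s|[b1 b2] hb|[a i] /= ha|[a i] /= ha] ->.
(* The inverse is the image under [psi], which stays on the parabola because [sg] is
   multiplicative. *)
- have -> : ((parab s)^-1)%g = parab (sg s.1, s.2); last exact: parab_gens.
  by rewrite /parab; congr (_, _, (_, _), _);
     rewrite /= ?sgN ?opprK // !expr2 sgM.
- have -> : ((vert (b1, b2))^-1)%g = vert (- b1, - b2).
    by congr (_, _, (_, _), _); rewrite /= ?oppr0.
  by rewrite vert_gens ?halfN.
- have [j ij] := shiftN i; have -> : ((fib1 (a, i))^-1)%g = fib1 (- a, j).
    by rewrite /fib1 ij; congr (_, _, (_, _), _); rewrite /= ?oppr0.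
  by rewrite fib1_gens ?oppr_eq0.
- have [j ij] := shiftN i; have -> : ((fib2 (a, i))^-1)%g = fib2 (- a, j).
    by rewrite /fib2 ij; congr (_, _, (_, _), _); rewrite /= ?oppr0.
  by rewrite fib2_gens ?oppr_eq0.
Qed.

Lemma gens_inv : (gens^-1)%g = gens.
Proof.
apply/setP => g; rewrite inE; apply/idP/idP => [/gens_inv_sub|/gens_inv_sub //].
by rewrite invgK.
Qed.

Lemma gens1 : (1%g : G) \notin gens.
Proof.
apply/negP => /gensP [s|[b1 b2] hb|[a i] /= ha|[a i] /= ha] E.
- by have := congr1 snd E.
- by move: hb; case: E => <- <-; rewrite /half eqxx.
- by case: E => E _; rewrite -E eqxx in ha.
- by case: E => E _; rewrite -E eqxx in ha.
Qed.

(** The point (0, 1) over [F1] is off the parabola and fixed by [psi], so this is an involution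
    outside [gens], as the parity correction requires. *)
Definition spare : G := (((0, 1), (0, 0)), true).

Lemma spare_inv : (spare^-1)%g = spare.
Proof.
by congr (_, _, (_, _), _); rewrite /= ?sgN ?opprK ?oppr0 ?sg0 ?sg1.
Qed.

Lemma spare_gens : spare \notin gens.
Proof.
apply/negP => /gensP [[s t]|[b1 b2] hb|[a i] /= ha|[a i] /= ha] E.
- by case: E => <- /eqP; rewrite expr0n oner_eq0.
- by have := congr1 snd E.
- by have := congr1 snd E.
- by have := congr1 snd E.
Qed.

Lemma cover_mul (a b g : G) : a \in gens -> b \in gens -> g = (a * b)%g ->
  [|| g == 1%g, g \in gens | [exists a in gens, (a^-1 * g)%g \in gens]].
Proof.
move=> ha hb ->; apply/or3P; constructor 3; apply/exists_inP.
by exists a => //; rewrite mulKg.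
Qed.

Lemma half_axis1 b1 : b1 != 0 -> half (b1, 0).
Proof. by move=> b10; rewrite /half xpair_eqE /= eqxx (negbTE b10) orbT. Qed.

Lemma half_axis2 b2 : b2 != 0 -> half (0, b2).
Proof.
by move=> b20; rewrite /half xpair_eqE /= sg0 subrr (negbTE b20) !eqxx.
Qed.

(** Nonzero vectors on either axis always satisfy [half], so two of them suffice. *)
Lemma cover_vert b : [|| vert b == 1%g, vert b \in gens |
  [exists a in gens, (a^-1 * vert b)%g \in gens]].
Proof.
case: b => b1 b2.
have [->|b10] := eqVneq b1 0; have [->|b20] := eqVneq b2 0.
- by rewrite eqxx.
- by rewrite vert_gens ?orbT ?half_axis2.
- by rewrite vert_gens ?orbT ?half_axis1.
apply: (@cover_mul (vert (b1, 0)) (vert (0, b2))).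
- by rewrite vert_gens ?half_axis1.
- by rewrite vert_gens ?half_axis2.
- by congr (_, _, (_, _), _); rewrite /= ?addr0 ?add0r.
Qed.

Lemma covers_gens : covers gens.
Proof.
case=> [[[a1 b1] [a2 b2]] []].
- pose c1 := b1 - a1 ^+ 2; pose c2 := b2 - a2 ^+ 2.
  (* Beside a parabola element, a vertical factor contributes itself on the left and its image under
     [twist] on the right. One of [c] and [psi c] is available unless [c] is zero. *)
  case/or3P: (half_sg c1 c2) => [/eqP [c10 c20] | hc | hc].
  + apply/or3P; constructor 2.
    have -> : ((a1, b1), (a2, b2), true) = parab (a1, a2).
      by congr (_, _, (_, _), _); apply/eqP; rewrite -subr_eq0 ?[_ - _]c10 ?[_ - _]c20.
    exact: parab_gens.
  + apply: (@cover_mul (vert (c1, c2)) (parab (a1, a2))).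
    * exact: vert_gens.
    * exact: parab_gens.
    * by congr (_, _, (_, _), _); rewrite /= ?add0r ?subrK.
  + apply: (@cover_mul (parab (a1, a2)) (vert (- sg c1, - c2))).
    * exact: parab_gens.
    * by rewrite vert_gens ?halfN.
    * by congr (_, _, (_, _), _); rewrite /= ?sgN ?sgK ?opprK ?sg0 ?oppr0
        ?addr0 // addrC subrK.
have [->|a10] := eqVneq a1 0; have [->|a20] := eqVneq a2 0.
- exact: (cover_vert (b1, b2)).
- have [i /orP hi] := half_shift b1 b2.
  case: hi => [/eqP [-> /eqP]|hi].
    rewrite subr_eq0 => /eqP ->; apply/or3P; constructor 2.
    exact: (@fib2_gens (a2, i)).
  apply: (@cover_mul (fib2 (a2, i)) (vert (b1, b2 - shift i))).
  + exact: fib2_gens.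
  + exact: vert_gens.
  + by congr (_, _, (_, _), _); rewrite /= ?add0r ?addr0 // addrC subrK.
- have [i /orP hi] := half_shift b1 b2.
  case: hi => [/eqP [-> /eqP]|hi].
    rewrite subr_eq0 => /eqP ->; apply/or3P; constructor 2.
    exact: (@fib1_gens (a1, i)).
  apply: (@cover_mul (fib1 (a1, i)) (vert (b1, b2 - shift i))).
  + exact: fib1_gens.
  + exact: vert_gens.
  + by congr (_, _, (_, _), _); rewrite /= ?add0r ?addr0 // addrC subrK.
(* [s - t = a] and [s^2 - t^2 = b] *)
pose s1 := (a1 + b1 / a1) / 2; pose t1 := (b1 / a1 - a1) / 2.
pose s2 := (a2 + b2 / a2) / 2; pose t2 := (b2 / a2 - a2) / 2.
(* The action on the second factor cancels [sg] and supplies the minus sign. *)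
apply: (@cover_mul (parab (s1, s2)) (parab (sg t1, t2))).
- exact: parab_gens.
- exact: parab_gens.
- congr (_, _, (_, _), _); rewrite /= ?expr2 ?sgM ?sgK /s1 /s2 /t1 /t2; field;
   by rewrite ?F1_2 ?F2_2 ?a10 ?a20.
Qed.


(** * Counting the generators *)

Local Notation fixsg := [set x | sg x == x].

(** Off the vectors with [b.1] fixed by [sg] or [b.2] zero, applying [sg] to [b.1] reverses only the
    [P1] side. Hence this part of [half] is disjoint from its image and fills at most half of the
    plane. *)
Lemma card_half : (#|[set b | half b]| * 2 <=
  #|fixsg| * #|F2| * 2 + #|F1| * 2 + #|F1| * #|F2|)%N.
Proof.
pose C := [set b : F1 * F2 | [&& b.1 - sg b.1 != 0, b.2 != 0 & half b]].
pose flip (b : F1 * F2) := (sg b.1, b.2).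
have flipI : injective flip.
  by move=> [b1 b2] [c1 c2] [] /(can_inj sgK) -> ->.
have cC : (#|C| * 2 <= #|F1| * #|F2|)%N.
  rewrite muln2 -addnn -{2}(card_imset _ flipI) -cardsUI -card_prod.
  suff -> : C :&: flip @: C = set0 by rewrite cards0 addn0 max_card.
  apply/setP => b; rewrite inE [RHS]inE; apply/negP => /andP [].
  rewrite inE => /and3P [y0 b0 hb] /imsetP [[c1 c2]].
  rewrite inE => /and3P [/= z0 c0 hc] E.
  move: y0 b0 hb hc; rewrite /half E /= sgK => y0 b0 /andP [_].
  rewrite (negbTE y0) (negbTE b0) /= => /eqP E1 /andP [_].
  rewrite (negbTE z0) /= => /eqP E2.
  by move: E1; rewrite -E2 -(opprB c1) P1N //; case: P1.
have sub : [set b | half b] \subset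
    (setX fixsg setT :|: setX setT [set 0]) :|: C.
  apply/subsetP => -[b1 b2]; rewrite !inE /= andbT => ->; rewrite andbT.
  by rewrite subr_eq0 [b1 == _]eq_sym; case: (sg b1 == b1); case: (b2 == 0).
have : (#|[set b | half b]| <= #|fixsg| * #|F2| + #|F1| * 1 + #|C|)%N.
  apply: leq_trans (subset_leq_card sub) _.
  apply: leq_trans (leq_card_setU _ _) _; rewrite leq_add2r.
  by apply: leq_trans (leq_card_setU _ _) _; rewrite !cardsX !cardsT cards1.
by lia.
Qed.

Lemma card_gens : (#|gens| * 2 <=
  3 * (#|F1| * #|F2|) + #|fixsg| * #|F2| * 2 + 8 * #|F1| + 6 * #|F2|)%N.
Proof.
have -> : gens = (parab @: setT :|: vert @: [set b | half b])
    :|: (fib1 @: [set a | a.1 != 0]) :|: (fib2 @: [set a | a.1 != 0]).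
  by apply/setP => g; rewrite !in_setU inE.
apply: leq_trans (_ : (#|F1| * #|F2| + #|[set b | half b]| + #|F1| * 3
   + #|F2| * 3) * 2 <= _)%N; last by have := card_half; lia.
rewrite leq_mul2r /=.
apply: leq_trans (leq_card_setU _ _) _; apply: leq_add.
  apply: leq_trans (leq_card_setU _ _) _; apply: leq_add.
    apply: leq_trans (leq_card_setU _ _) _; apply: leq_add.
      by apply: leq_trans (leq_imset_card _ _) _; rewrite cardsT card_prod.
    exact: leq_imset_card.
  apply: leq_trans (leq_imset_card _ _) _.
  by apply: leq_trans (max_card _) _; rewrite card_prod card_ord.
apply: leq_trans (leq_imset_card _ _) _.
by apply: leq_trans (max_card _) _; rewrite card_prod card_ord.
Qed.

Lemma cayley_of_planes (d : nat) (Q : nat -> Prop) :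
  (3 * (#|F1| * #|F2|) + #|fixsg| * #|F2| * 2 + 8 * #|F1| + 6 * #|F2| <= d * 2)%N ->
  (d.+2 <= 2 * (#|F1| * #|F2|) ^ 2)%N -> Q (2 * (#|F1| * #|F2|) ^ 2)%N ->
  cayley_d2_exists_gt d Q.
Proof.
have cG : #|{: G}| = (2 * (#|F1| * #|F2|) ^ 2)%N.
  by rewrite card_invol_ext !card_prod expnMn mulnC -!mulnn.
move=> dlo dhi HQ; apply: (@cayley_of_cover G gens spare) => //.
- exact: gens_inv.
- exact: gens1.
- exact: spare_inv.
- by apply/eqP => E; have := congr1 snd E.
- exact: spare_gens.
- by rewrite -(@leq_pmul2r 2) //; apply: leq_trans card_gens dlo.
- by rewrite cG.
- exact: covers_gens.
- by rewrite cG.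
Qed.

End Construction.

(** * Sign classes in finite fields and fixed points of Frobenius *)

Section PrimeField.
Variable p : nat.
Hypotheses (pp : prime p) (op : odd p).
Local Open Scope ring_scope.

Definition low : pred 'F_p := fun x => (x <= p./2)%N.

Lemma Fp_val_lt (x : 'F_p) : (x < p)%N.
Proof. by have := ltn_ord x; rewrite [in X in (_ < X)%N]Fp_cast. Qed.

Lemma Fp_valE (x : 'F_p) : x = (x : nat)%:R.
Proof. by rewrite natr_Zp. Qed.

Lemma Fp_val_eq0 (x : 'F_p) : x != 0 -> (0 < x)%N.
Proof.
by rewrite lt0n; apply: contra => /eqP E; rewrite (Fp_valE x) E.
Qed.

Lemma Fp_valN (x : 'F_p) : x != 0 -> (- x : 'F_p) = (p - x)%N :> nat.
Proof.
move=> x0; have xp := Fp_val_lt x; have xpos := Fp_val_eq0 x0.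
have -> : - x = (p - x)%:R.
  by rewrite natrB ?(ltnW xp) // pchar_Fp_0 // sub0r -Fp_valE.
by rewrite val_Fp_nat // modn_small //; lia.
Qed.

Lemma low_natr m : (m < p)%N -> low m%:R = (m <= p./2)%N.
Proof. by move=> mp; rewrite /low val_Fp_nat // modn_small. Qed.

Lemma lowN x : x != 0 -> low (- x) = ~~ low x.
Proof.
move=> x0; rewrite /low Fp_valN //.
by have := Fp_val_lt x; have := Fp_val_eq0 x0; lia.
Qed.

Lemma low_sub x : x != 0 -> low x ->
  (x - (p./2)%:R == 0) || ~~ low (x - (p./2)%:R).
Proof.
move=> x0 lx; have := Fp_val_eq0 x0; have xp := Fp_val_lt x => xpos.
have [//|n0] := eqVneq (x - (p./2)%:R) 0.
(* The negative (p-1)/2 - x is the residue of a natural number at most (p-1)/2. *)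
rewrite orFb -lowN // opprB {1}(Fp_valE x) -natrB // low_natr; lia.
Qed.

Lemma low_add x : x != 0 -> ~~ low x ->
  (x + (p./2)%:R == 0) || low (x + (p./2)%:R).
Proof.
move=> x0; rewrite /low -ltnNge => lx; have xp := Fp_val_lt x.
apply/orP; right; rewrite -/(low _).
(* The sum of an upper residue and (p-1)/2 wraps past [p] exactly once and lands below (p-1)/2. *)
have -> : x + (p./2)%:R = (x + p./2 - p)%:R.
  by rewrite natrB ?pchar_Fp_0 ?subr0 ?natrD -?Fp_valE //; lia.
by rewrite low_natr; lia.
Qed.

End PrimeField.

Section HalfSystem.
Local Open Scope ring_scope.

Lemma half_system (F : finFieldType) : (2 : F) != 0 ->
  exists P : pred F, forall x, x != 0 -> P (- x) = ~~ P x.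
Proof.
(* Of [x] and [-x], distinct in odd characteristic, the one enumerated first is chosen. *)
move=> F2; exists (fun x => (enum_rank x < enum_rank (- x))%N) => x x0.
suff ne : enum_rank x != enum_rank (- x).
  rewrite opprK -leqNgt ltn_neqAle; case: eqP => // /ord_inj E.
  by rewrite E eqxx in ne.
rewrite (inj_eq enum_rank_inj); apply: contra x0 => /eqP E.
have : x * 2 == 0 by rewrite mulr_natr mulr2n {1}E addNr.
by rewrite mulf_eq0 (negbTE F2) orbF.
Qed.

Lemma card_frobenius_fixed (F : finFieldType) n : (1 < n)%N ->
  (#|[set x : F | x ^+ n == x]| <= n)%N.
Proof.
move=> n1; pose P : {poly F} := 'X^n - 'X.
have sP : size P = n.+1 by rewrite size_polyDl ?size_polyXn // size_polyN size_polyX.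
rewrite cardE -ltnS -sP; apply: max_poly_roots; last exact: enum_uniq.
  by rewrite -size_poly_gt0 sP.
apply/allP => x; rewrite mem_enum inE => /eqP E.
by rewrite /root !hornerE ?hornerXn E subrr.
Qed.

End HalfSystem.

(** * Choice of fields for each degree *)

(** The first inequality bounds twice the number of generators, Frobenius having at most 3^r fixed
    points; the second compares the group order 2 (9^r p)^2 with 0.684 d^2. *)
Lemma cayley_9_prime (r p d : nat) : 0 < r -> prime p -> odd p ->
  3 * (9 ^ r * p) + 3 ^ r * p * 2 + 8 * 9 ^ r + 6 * p <= d * 2 ->
  684 * d ^ 2 < 2000 * (9 ^ r * p) ^ 2 ->
  cayley_d2_exists_gt d (fun n => 684 * d ^ 2 < 1000 * n).
Proof.
move=> r0 pp op dlo dhi.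
have [|F1 F1c cF1] := @pPrimePowerField 3 (2 * r) isT; first by lia.
pose sg (x : F1) := (x ^+ (3 ^ r))%R.
have sgD : {morph sg : x y / (x + y)%R}.
  move=> x y; apply: exprDn_pchar; rewrite pnatX orbC.
  by rewrite (eq_pnat _ (pcharf_eq F1c)) pnat_id ?orbT.
have sgM : {morph sg : x y / (x * y)%R} by move=> x y; exact: exprMn.
have sgK : involutive sg.
  move=> x; rewrite /sg -exprM.
  by rewrite -expnD addnn -mul2n -cF1 expf_card.
have F12 : (2 : F1)%R != 0%R by rewrite -(dvdn_pcharf F1c).
have F22 : (2 : 'F_p)%R != 0%R.
  rewrite -(dvdn_pcharf (pchar_Fp pp)); apply/negP => /(@dvdn_leq _ 2 isT).
  by have := prime_gt1 pp; lia.
have [P1 HP1] := half_system F12.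
apply: (@cayley_of_planes F1 'F_p sg sgD sgM sgK F12 F22 P1 (@low p)
  (p./2)%:R%R HP1 (lowN pp op) (low_sub pp op) (low_add pp op));
  rewrite ?card_Fp // cF1 expnM -[3 ^ 2]/9; move: dlo dhi.
- have : #|[set x | sg x == x]| <= 3 ^ r.
    by apply: card_frobenius_fixed; rewrite -(expn0 3) ltn_exp2l.
  move=> H dlo _; apply: leq_trans dlo; rewrite !leq_add2r leq_add2l.
  by apply: leq_mul => //; apply: leq_mul.
- move=> _; have : 2 <= 9 ^ r * p.
    by apply: leq_trans (prime_gt1 pp) _; rewrite leq_pmull // expn_gt0.
  by rewrite -!mulnn; move: (9 ^ r * p) => N; nia.
- by move=> _; rewrite -!mulnn; move: (9 ^ r * p) => N; nia.
Qed.

(** Either [p] is the witness, or its failure raises the lower bound on [d] to what the next prime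
    needs. *)
Ltac try_prime Q d p :=
  (have [?|{}dlo] : 10 * 1000 * d < (17 * 1000 + 99) * 729 * (Q * p) \/
      (17 * 1000 + 99) * 729 * (Q * p) <= 10 * 1000 * d
    by lia);
  [exists p; split; [by [] | by [] | lia | lia] | ].

(* [17099 / 10000] is just below [sqrt (2000 / 684)]; [Q] stands for [9^(r-3)]. *)
Lemma prime_window (Q d : nat) : 0 < Q -> (396 * 911) * Q <= d < (396 * 911) * (9 * Q) ->
  exists p, [/\ prime p, odd p, Q * (2247 * p + 8 * 729) <= d * 2 &
     10 * 1000 * d < (17 * 1000 + 99) * 729 * (Q * p)].
Proof.
move=> Q0 /andP [dlo dhi].
try_prime Q d 317. try_prime Q d 349. try_prime Q d 383. try_prime Q d 421.
try_prime Q d 463. try_prime Q d 509. try_prime Q d 557. try_prime Q d 613.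
try_prime Q d 677. try_prime Q d 743. try_prime Q d 821. try_prime Q d 907.
try_prime Q d 997. try_prime Q d 1103. try_prime Q d 1217. try_prime Q d 1327.
try_prime Q d 1459. try_prime Q d 1613. try_prime Q d 1787. try_prime Q d 1979.
try_prime Q d 2179. try_prime Q d 2411. try_prime Q d 2671.
by lia.
Qed.

(** Consecutive windows differ by a factor 9 in [Q], so one list of primes serves all degrees. *)
Lemma power9_window d : (396 * 911) <= d ->
  exists k, (396 * 911) * 9 ^ k <= d < (396 * 911) * (9 * 9 ^ k).
Proof.
move=> hd; pose k := trunc_log 9 (d %/ (396 * 911)); exists k.
have d0 : 0 < d %/ (396 * 911) by rewrite divn_gt0 //; lia.
have /andP [lo hi] := trunc_log_bounds (isT : 1 < 9) d0.
rewrite -expnS; move: lo hi; rewrite -/k.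
by move: (9 ^ k) (9 ^ k.+1) => a b; lia.
Qed.

(* Literals above 5000 are not unfolded by [lia], hence this and the factored
   constants in the two lemmas above. *)
Lemma literal_360756 : 360756 = 396 * 911.
Proof.
rewrite [LHS]DecimalNat.Unsigned.of_uint_alt.
by cbn [Decimal.rev Decimal.revapp DecimalNat.Unsigned.of_lu
  DecimalNat.Unsigned.hd DecimalNat.Unsigned.tl]; lia.
Qed.

Theorem mainTheorem6 (d : nat) (hd : 360756 <= d) :
  cayley_d2_exists_gt d (fun n => 684 * d ^ 2 < 1000 * n).
Proof.
move: hd; rewrite literal_360756 => hd'.
have [k dk] := power9_window hd'.
have Q0 : 0 < 9 ^ k by rewrite expn_gt0.
have [p [pp op plo phi]] := prime_window Q0 dk.
apply: (@cayley_9_prime (k + 3) p) => //; first by rewrite addn3.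
(* With [Q] = 9^k one has 9^(k+3) = 729 Q, and 3^k and 1 are at most [Q]; hence the coefficient 2247
   = 3*729 + 2*27 + 6 of [p] in [plo]. *)
- have le39 : 3 ^ k * p <= 9 ^ k * p.
    by rewrite leq_mul2r -[9]/(3 * 3) expnMn leq_pmulr ?orbT // expn_gt0.
  have lep : p <= 9 ^ k * p by rewrite leq_pmull.
  rewrite !expnD; move: plo le39 lep; rewrite mulnDr.
  rewrite -[9 ^ 3]/(9 * 9 * 9) -[3 ^ 3]/(3 * 3 * 3).
  by move: (9 ^ k) (3 ^ k) => Q S; lia.
- have {phi} : 10 * 1000 * d < (17 * 1000 + 99) * (9 ^ (k + 3) * p).
    by rewrite expnD -[9 ^ 3]/(9 * 9 * 9); move: phi; lia.
  by rewrite -!mulnn; move: (9 ^ _ * p) => N; nia.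
Qed.
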